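(* Let $p,q$ be primes with $p>2$, $q\equiv 1\pmod p$ and $q\not\equiv 1\pmod{p^2}$, and let $r$ be a fixed element of order $p$ in $\mathbb{Z}_q^\times$. Up to isomorphism, the left braces of size $p^2q$ with cyclic additive group and with $|\ker\lambda|=pq$ are exactly the braces $B_{(j,k)}$ for $(j,k)\in\{(1,0)\}\cup\{(j,1):0\le j\le p-1\}$, distinct pairs giving non-isomorphic braces, where $B_{(j,k)}=(\mathbb{Z}_{p^2}\times\mathbb{Z}_q,+,\circ)$ with $$\begin{pmatrix} n\\ m\end{pmatrix}+\begin{pmatrix} s\\ t\end{pmatrix}=\begin{pmatrix} n+s\\ m+t\end{pmatrix},\qquad \begin{pmatrix} n\\ m\end{pmatrix}\circ\begin{pmatrix} s\\ t\end{pmatrix}=\begin{pmatrix} n+(jnp+1)s\\ m+r^{kn}t\end{pmatrix}$$ for all $n,s\in\mathbb{Z}_{p^2}$ and $m,t\in\mathbb{Z}_q$. In particular, $(B_{(j,k)},\circ)\cong\mathbb{Z}_{p^2q}$ if $(j,k)=(1,0)$, and $(B_{(j,k)},\circ)\cong\mathbb{Z}_q\rtimes_r\mathbb{Z}_{p^2}$ otherwise.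
   Context: A skew (left) brace is a triple $(B,+,\circ)$ where $(B,+)$ and $(B,\circ)$ are groups such that $a\circ(b+c)=a\circ b-a+a\circ c$ for all $a,b,c\in B$; it is a left brace if $(B,+)$ is abelian. The map $\lambda:(B,\circ)\to\mathrm{Aut}(B,+)$, $\lambda_a(b)=-a+a\circ b$, is a group homomorphism, with kernel $\ker\lambda$. Isomorphisms are bijections preserving both operations. $\mathbb{Z}_q\rtimes_r\mathbb{Z}_{p^2}=\langle\sigma,\tau\mid\sigma^{p^2}=\tau^q=1,\ \sigma\tau\sigma^{-1}=\tau^r\rangle$. *)

(* Defs.v *)
From HB Require Import structures.
From mathcomp Require Import all_boot all_fingroup all_algebra all_solvable.
From mathcomp Require Import ring.

Set Implicit Arguments.
Unset Strict Implicit.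
Unset Printing Implicit Defensive.

Import GRing.Theory.
Local Open Scope ring_scope.

(* A left brace is a skew left brace whose additive group is abelian, i.e. a
   zmodType. The identity [circ1] and the inverse [circV] of the second group
   are part of the data, but they are determined by [circ]. *)
HB.mixin Record isLeftBrace B of GRing.Zmodule B := {
  circ : B -> B -> B;
  circ1 : B;
  circV : B -> B;
  circA : associative circ;
  circ1b : left_id circ1 circ;
  circVb : left_inverse circ1 circV circ;
  circDr : forall a b c : B, circ a (b + c) = circ a b - a + circ a c
}.

#[short(type="leftBraceType")]
HB.structure Definition LeftBrace := {B of isLeftBrace B & GRing.Zmodule B}.

#[short(type="finLeftBraceType")]
HB.structure Definition FinLeftBrace := {B of LeftBrace B & Finite B}.

Declare Scope brace_scope.
Delimit Scope brace_scope with brace.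
Notation "a ∘ b" := (circ a b)
  (at level 40, left associativity) : brace_scope.
Local Open Scope brace_scope.

Definition add_group (B : finLeftBraceType) : finGroupType := (B : finZmodType).

Definition circ_group (B : finLeftBraceType) : Type := B.

HB.instance Definition _ (B : finLeftBraceType) :=
  Finite.copy (circ_group B) B.
HB.instance Definition _ (B : finLeftBraceType) :=
  Finite_isGroup.Build (circ_group B) (@circA B) (@circ1b B) (@circVb B).

Definition lambda (B : leftBraceType) (a b : B) : B := - a + a ∘ b.

Definition ker_lambda (B : finLeftBraceType) : {set B} :=
  [set a | [forall b, lambda a b == b]].

Definition brace_iso (B C : leftBraceType) : Prop :=
  exists f : B -> C,
    [/\ bijective f,
        forall a b, f (a + b) = f a + f b
      & forall a b, f (a ∘ b) = f a ∘ f b].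

Section BjkOps.

Variables (p q : nat) (r : {unit 'Z_q}) (j k : nat).

(* The exponent [k * n] uses the representative of [n] in [0, p ^ 2[; the value
   of the power does not depend on it, because [r] has order [p]. *)
Definition Bjk_circ (x y : 'Z_(p ^ 2) * 'Z_q) : 'Z_(p ^ 2) * 'Z_q :=
  let: (n, m) := x in let: (s, t) := y in
  (n + (j%:R * n * p%:R + 1) * s, m + val r ^+ (k * n) * t).

Definition Bjk_circV (x : 'Z_(p ^ 2) * 'Z_q) : 'Z_(p ^ 2) * 'Z_q :=
  let: (n, m) := x in
  let n' := - ((1 - j%:R * n * p%:R) * n) in
  (n', - (val r ^+ (k * n') * m)).

Hypotheses (p_prime : prime p) (r_order : #[r]%g = p).

Let p2_gt1 : (1 < p ^ 2)%N.
Proof. by rewrite -[1%N](exp1n 2) ltn_exp2r // prime_gt1. Qed.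

Let r_mod m n : m = n %[mod p] -> val r ^+ m = val r ^+ n.
Proof.
move=> e; have rp : val r ^+ p = 1.
  by rewrite -FinRing.val_unitX -r_order expg_order.
by rewrite -(expr_mod _ rp) e expr_mod.
Qed.

Let val_Zp2 (n : nat) : nat_of_ord (n%:R : 'Z_(p ^ 2)) = n %[mod p].
Proof. by rewrite val_Zp_nat // modn_dvdm // dvdn_exp. Qed.

Let exp_circ (n s : 'Z_(p ^ 2)) :
  val r ^+ (k * (n + (j%:R * n * p%:R + 1) * s)%R)%N =
  val r ^+ (k * n) * val r ^+ (k * s).
Proof.
rewrite -exprD -mulnDr; apply: r_mod.
rewrite -modnMmr -[RHS]modnMmr; congr ((_ * _) %% _)%N.
have -> : n + (j%:R * n * p%:R + 1) * s
        = (n + (j * n * p + 1) * s)%:R :> 'Z_(p ^ 2).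
  by rewrite !(natrD, natrM) !natr_Zp.
by rewrite val_Zp2 mulnDl mul1n addnCA mulnAC modnMDl.
Qed.

Fact Bjk_circA : associative Bjk_circ.
Proof.
move=> [n m] [s t] [u v]; rewrite /Bjk_circ exp_circ; congr pair; ring.
Qed.

Fact Bjk_circ1b : left_id 0 Bjk_circ.
Proof. by case=> s t; rewrite /Bjk_circ /= muln0; congr pair; ring. Qed.

Fact Bjk_circVb : left_inverse 0 Bjk_circV Bjk_circ.
Proof.
case=> n m; rewrite /Bjk_circ /Bjk_circV; congr pair; last by rewrite addNr.
have p2_eq0 : p%:R * p%:R = 0 :> 'Z_(p ^ 2) by rewrite -natrM mulnn pchar_Zp.
transitivity (j%:R ^+ 2 * n ^+ 3 * (p%:R * p%:R)); first by ring.
by rewrite p2_eq0 mulr0.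
Qed.

Fact Bjk_circDr x y z :
  Bjk_circ x (y + z) = Bjk_circ x y - x + Bjk_circ x z.
Proof.
case: x y z => [n m] [s t] [u v]; rewrite /Bjk_circ; congr pair => /=; ring.
Qed.

End BjkOps.

Definition Bjk (p q : nat) (r : {unit 'Z_q}) (p_prime : prime p)
  (r_order : #[r]%g = p) (j k : nat) : Type := ('Z_(p ^ 2) * 'Z_q)%type.

Section BjkBrace.

Variables (p q : nat) (r : {unit 'Z_q}).
Variables (p_prime : prime p) (r_order : #[r]%g = p) (j k : nat).

Local Notation B := (Bjk p_prime r_order j k).

HB.instance Definition _ := Finite.copy B ('Z_(p ^ 2) * 'Z_q)%type.
HB.instance Definition _ := GRing.Zmodule.copy B ('Z_(p ^ 2) * 'Z_q)%type.
HB.instance Definition _ :=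
  isLeftBrace.Build B (Bjk_circA j k p_prime r_order) (@Bjk_circ1b p q r j k)
    (Bjk_circVb r j k p_prime) (@Bjk_circDr p q r j k).

End BjkBrace.

Definition jk_pairs (p : nat) : seq (nat * nat) :=
  (1, 0)%N :: [seq (j, 1)%N | j <- iota 0 p].

(* Main.v *)
(* Transport [B] to the ring [R = Z_(p^2) * Z_q]: an additive endomorphism of
   [R] is multiplication by an element, so [x o y = x + u(x) y], where
   [u(x o y) = u(x) u(y)] and [u(x)^p = 1] because [ker lambda] has index [p].
   As [p] and [q] are coprime, [u] is trivial on [0 * Z_q], so [u(n, m)] depends
   only on [n], and since [p] is odd, [u(n, m) = u(1, 0)^n]. The element
   [u(1, 0)] has order [p], hence is [(1 + j p, r^k)] for some [j] and [k], not
   both divisible by [p]. An additive automorphism [(c, d)] of [R] replaces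
   [(j, k)] by [(j / c, k / c)], so the isomorphism classes are the points of
   the projective line over [F_p], which [jk_pairs] enumerates. *)

Require Import Defs.
From HB Require Import structures.
From mathcomp Require Import all_boot all_fingroup all_algebra all_solvable.
From mathcomp Require Import ring.

Set Implicit Arguments.
Unset Strict Implicit.
Unset Printing Implicit Defensive.

Import GRing.Theory.
Local Open Scope ring_scope.
Local Open Scope brace_scope.

(** * Residue rings and additive maps of ['Z_N * 'Z_M] *)

Lemma Zp_natr_eq N a b : (1 < N)%N -> (a%:R == b%:R :> 'Z_N) = (a == b %[mod N]).
Proof. by move=> N_gt1; rewrite -val_eqE /= !val_Zp_nat. Qed.

Lemma Zp_natr_surj N (x : 'Z_N) : exists a : nat, x = a%:R.
Proof. by exists (nat_of_ord x); rewrite natr_Zp. Qed.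

Lemma pair_natr (A A' : pzSemiRingType) n : 1 *+ n = (n%:R, n%:R) :> A * A'.
Proof. by elim: n => // n IHn; rewrite !mulrS IHn. Qed.

Lemma pair_expr (A A' : pzSemiRingType) (x : A * A') n :
  x ^+ n = (x.1 ^+ n, x.2 ^+ n).
Proof. by elim: n => [|n IHn]; last rewrite !exprS IHn. Qed.

Lemma Zp_pair_natr N M (x : 'Z_N * 'Z_M) : (1 < N)%N -> (1 < M)%N ->
  coprime N M -> exists n : nat, x = 1 *+ n.
Proof.
move=> N_gt1 M_gt1 co; case: x => a b; exists (chinese N M a b).
rewrite pair_natr; congr pair; rewrite -[LHS]natr_Zp; apply/eqP.
  by rewrite Zp_natr_eq // chinese_modl.
by rewrite Zp_natr_eq // chinese_modr.
Qed.

(** By the Chinese remainder theorem [1] generates the additive group, so its image determines the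
    map. *)
Lemma additive_Zp_pair N M (f : 'Z_N * 'Z_M -> 'Z_N * 'Z_M) :
    (1 < N)%N -> (1 < M)%N -> coprime N M ->
    (forall x y, f (x + y) = f x + f y) ->
  forall x, f x = f 1 * x.
Proof.
move=> N_gt1 M_gt1 co fD x; have [n ->] := Zp_pair_natr x N_gt1 M_gt1 co.
rewrite mulrnAr mulr1; elim: n => [|n IHn]; last by rewrite !mulrS fD IHn.
by rewrite !mulr0n; apply: (addrI (f 0)); rewrite -fD !addr0.
Qed.

Arguments Bjk_circ : simpl never.

(** * Isomorphisms between the braces [Bjk j k] *)

Section Bjk.

Variables (p q : nat) (r : {unit 'Z_q}).
Hypotheses (p_prime : prime p) (r_order : #[r]%g = p).

Local Notation R := ('Z_(p ^ 2) * 'Z_q)%type.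
Local Notation Bjk := (Bjk p_prime r_order).

Lemma prime_sqr_gt1 : (1 < p ^ 2)%N.
Proof. by rewrite -[1%N](exp1n 2) ltn_exp2r // prime_gt1. Qed.

Lemma natr_p_sqr : p%:R * p%:R = 0 :> 'Z_(p ^ 2).
Proof. by rewrite -natrM mulnn pchar_Zp ?prime_sqr_gt1. Qed.

Lemma natr_mulp_eq a b :
  (a%:R * p%:R == b%:R * p%:R :> 'Z_(p ^ 2)) = (a == b %[mod p]).
Proof.
rewrite -!natrM Zp_natr_eq ?prime_sqr_gt1 // expnS expn1 -!muln_modl.
by rewrite eqn_pmul2r ?prime_gt0.
Qed.

Lemma expr_r_eq m n : (val r ^+ m == val r ^+ n) = (m == n %[mod p]).
Proof.
rewrite -!FinRing.val_unitX -r_order -eq_expg_mod_order.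
by apply/eqP/eqP => [/val_inj|->].
Qed.

Lemma expr_r_Zp k n :
  val r ^+ (k * (n%:R : 'Z_(p ^ 2))) = val r ^+ (k * n).
Proof.
apply/eqP; rewrite expr_r_eq val_Zp_nat ?prime_sqr_gt1 //.
by rewrite -modnMmr modn_dvdm ?modnMmr // dvdn_exp.
Qed.

Lemma circ_Bjk j k (x y : Bjk j k) : x ∘ y = Bjk_circ r j k x y.
Proof. by []. Qed.

(** Frees the exponent of [r] from the representative in ['Z_(p ^ 2)]: any natural number [a] naming
    the first coordinate can be used. *)
Lemma Bjk_circE j k a b (s : 'Z_(p ^ 2)) (t : 'Z_q) :
  Bjk_circ r j k (a%:R, b) (s, t) =
  (a%:R + (j%:R * a%:R * p%:R + 1) * s, b + val r ^+ (k * a) * t).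
Proof. by rewrite /Bjk_circ expr_r_Zp. Qed.

(** The isomorphism multiplies the first coordinate by the unit [c] and fixes the second. *)
Lemma Bjk_scale j k j' k' c : coprime p c ->
    j = j' * c %[mod p] -> k = k' * c %[mod p] ->
  brace_iso (Bjk j k) (Bjk j' k').
Proof.
move=> co_pc /eqP jE /eqP kE.
have c_unit : (c%:R : 'Z_(p ^ 2)) \is a GRing.unit.
  by rewrite unitZpE ?prime_sqr_gt1 // coprimeXl.
pose f (x : Bjk j k) : Bjk j' k' := (c%:R * x.1, x.2).
exists f; split.
- exists (fun x => (c%:R^-1 * x.1, x.2)) => -[n m];
  by rewrite /f /= ?mulKr ?mulVKr.
- by case=> [n m] [s t]; congr pair; rewrite /= mulrDr.
case=> [n m] [s t]; have [a ->] := Zp_natr_surj n.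
rewrite !circ_Bjk /f Bjk_circE /= -(natrM _ c a) Bjk_circE; congr pair.
  move: jE; rewrite -natr_mulp_eq natrM => /eqP jE.
  rewrite mulrAC jE natrM; ring.
congr (_ + _ * _); apply/eqP; rewrite expr_r_eq mulnA.
by rewrite -modnMml (eqP kE) modnMml.
Qed.

Lemma Bjk_iso_inv j k j' k' : coprime (p ^ 2) q -> (1 < q)%N ->
  brace_iso (Bjk j k) (Bjk j' k') ->
  exists c : nat, j = j' * c %[mod p] /\ k = k' * c %[mod p].
Proof.
move=> co q_gt1 [f [[g fK gK] fD fM]].
have fE : forall x : R, f x = (f 1 : R) * x.
  exact: (additive_Zp_pair prime_sqr_gt1 q_gt1 co fD).
have [fU1 fU2] : (f 1 : R).1 * (g 1 : R).1 = 1 /\ (f 1 : R).2 * (g 1 : R).2 = 1.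
  have := gK (1 : R); rewrite fE => e.
  by split; [exact: (congr1 fst e) | exact: (congr1 snd e)].
case: (f 1 : R) fE fU1 fU2 => c d fE /= cU dU {fD}.
have [a aE] := Zp_natr_surj c; rewrite {c}aE in fE cU; exists a.
have {}fE n m : f (n, m) = (a%:R * n, d * m) by rewrite fE.
(* This single product suffices: its coordinates give [a j p = j' a p a] and [d r^k = r^(k' a) d].
   The units [a] and [d], whose inverses are the coordinates of [g 1], then cancel. *)
have := fM (1%:R, 0) (1, 1); rewrite !circ_Bjk Bjk_circE !fE mulr0 !mulr1.
rewrite Bjk_circE !add0r => e.
have /= [e1 e2] := (congr1 fst e, congr1 snd e); split; apply/eqP => {e}.
  rewrite -natr_mulp_eq; apply/eqP; move: e1; rewrite !mulrDr mulr1 mulrDl.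
  move/addrI; rewrite mul1r => /addIr e1.
  transitivity (a%:R * (j%:R * p%:R) * (g 1 : R).1).
    by rewrite mulrAC cU mul1r.
  by rewrite e1 -mulrA cU mulr1 natrM.
rewrite -expr_r_eq; apply/eqP; move: e2; rewrite muln1 => e2.
transitivity (d * val r ^+ k * (g 1 : R).2).
  by rewrite mulrAC dU mul1r.
by rewrite e2 -mulrA dU mulr1.
Qed.

End Bjk.

(** * Invariance of size, additive cyclicity and kernel size under isomorphism *)

Lemma add_group_expg (B : finLeftBraceType) (x : B) n :
  ((x : add_group B) ^+ n)%g = x *+ n.
Proof. by elim: n => // n IHn; rewrite expgS IHn mulrS. Qed.

Lemma cyclic_add_groupP (B : finLeftBraceType) :
  reflect (exists x : B, forall y, exists n : nat, y = x *+ n)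
          (cyclic [set: add_group B]).
Proof.
apply: (iffP cyclicP) => -[x xP]; exists x; first move=> y.
  have /cycleP[n ->] : (y : add_group B) \in <[x : add_group B]>%g.
    by rewrite -xP inE.
  by exists n; rewrite add_group_expg.
apply/setP => y; rewrite inE; have [n ->] := xP y.
by rewrite -add_group_expg mem_cycle.
Qed.

Lemma brace_iso_trans (B C D : leftBraceType) :
  brace_iso B C -> brace_iso C D -> brace_iso B D.
Proof.
move=> [f [f_bij fD fM]] [g [g_bij gD gM]]; exists (g \o f); split.
- exact: bij_comp.
- by move=> a b; rewrite /= fD gD.
- by move=> a b; rewrite /= fM gM.
Qed.

Section BraceIso.

Variables B C : finLeftBraceType.
Hypothesis isoBC : brace_iso B C.

Lemma brace_iso_card : #|B| = #|C|.
Proof. by have [f [/bij_eq_card]] := isoBC. Qed.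

Lemma brace_iso_cyclic : cyclic [set: add_group C] -> cyclic [set: add_group B].
Proof.
have [f [[g fK gK] fD _]] := isoBC => /cyclic_add_groupP[x xP].
apply/cyclic_add_groupP; exists (g x) => y; have [n fy] := xP (f y); exists n.
apply: (can_inj fK); rewrite fy; elim: {fy} n => [|n IHn].
  by rewrite !mulr0n; apply: (addrI (f 0)); rewrite -fD !addr0.
by rewrite !mulrS fD gK IHn.
Qed.

Lemma brace_iso_ker_lambda : #|ker_lambda B| = #|ker_lambda C|.
Proof.
have [f [[g fK gK] fD fM]] := isoBC.
have lambda_f a b : lambda (f a) (f b) = f (lambda a b).
  by apply: (addrI (f a)); rewrite -fD /lambda !addrA !subrr !add0r.
rewrite -(card_imset _ (can_inj fK)); congr #|pred_of_set _|; apply/setP => y.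
rewrite -[y]gK (mem_imset _ _ (can_inj fK)) !inE.
apply/forallP/forallP => yP b; last first.
  by rewrite -(inj_eq (can_inj fK)) -lambda_f.
by rewrite -[b]gK lambda_f (inj_eq (can_inj fK)).
Qed.

End BraceIso.

(** * Size, additive group and kernel of [Bjk j k] *)

Section BjkInvariants.

Variables (p q : nat) (r : {unit 'Z_q}).
Hypotheses (p_prime : prime p) (r_order : #[r]%g = p).
Hypotheses (q_gt1 : (1 < q)%N) (co_pq : coprime p q).

Local Notation R := ('Z_(p ^ 2) * 'Z_q)%type.
Local Notation Bjk := (Bjk p_prime r_order).

Let p2_gt1 : (1 < p ^ 2)%N := prime_sqr_gt1 p_prime.

Lemma card_Bjk j k : #|(Bjk j k : finLeftBraceType)| = (p ^ 2 * q)%N.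
Proof. by rewrite card_prod !card_ord !Zp_cast. Qed.

Lemma cyclic_Bjk j k : cyclic [set: add_group (Bjk j k)].
Proof.
apply/cyclic_add_groupP; exists (1 : R) => y.
by apply: (Zp_pair_natr (y : R)); rewrite ?coprimeXl.
Qed.

Lemma mem_ker_Bjk j k (x : Bjk j k) :
  (x \in ker_lambda (Bjk j k)) = (p %| j * x.1)%N && (p %| k * x.1)%N.
Proof.
case: x => n m; rewrite inE /=.
have lambdaE (s : 'Z_(p ^ 2)) (t : 'Z_q) : lambda ((n, m) : Bjk j k) (s, t) =
    ((j%:R * n * p%:R + 1) * s, val r ^+ (k * n) * t).
  by congr pair; rewrite /= addrA addNr add0r.
have jE : (p %| j * n)%N = (j%:R * n * p%:R == 0).
  rewrite -{2}[n]natr_Zp -natrM; have := natr_mulp_eq p_prime (j * n) 0.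
  by rewrite mul0r mod0n => ->.
have kE : (p %| k * n)%N = (val r ^+ (k * n) == 1).
  by rewrite -(expr0 (val r)) (expr_r_eq r_order) mod0n.
rewrite jE kE; apply/forallP/andP => [xP|[/eqP j0 /eqP k0] [s t]].
  (* [lambda] multiplies each coordinate by a scalar, so its value at [(1, 1)] shows both
     scalars. *)
  have := xP (1, 1); rewrite lambdaE !mulr1 => /eqP e; split; apply/eqP.
    by apply: (addIr 1); rewrite add0r; exact: (congr1 fst e).
  exact: (congr1 snd e).
by rewrite lambdaE j0 k0 add0r !mul1r.
Qed.

Lemma card_dvdn_Zp_sqr : #|[set n : 'Z_(p ^ 2) | (p %| n)%N]| = p.
Proof.
have p_gt0 := prime_gt0 p_prime.
pose f (i : 'I_p) : 'Z_(p ^ 2) := i%:R * p%:R.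
have f_inj : injective f.
  move=> i i' /eqP; rewrite natr_mulp_eq // !modn_small //.
  by move/eqP/val_inj.
rewrite -[RHS]card_ord -(card_imset _ f_inj); congr #|pred_of_set _|.
apply/setP => n; rewrite inE; apply/idP/imsetP => [/dvdnP[i iE]|[i _ ->]].
  have lt_ip : (i < p)%N.
    rewrite -(ltn_pmul2r p_gt0) -iE mulnn -[leqRHS](Zp_cast p2_gt1).
    exact: ltn_ord.
  by exists (Ordinal lt_ip); rewrite // /f -natrM -iE natr_Zp.
by rewrite /f -natrM val_Zp_nat // /dvdn modn_dvdm ?modnMl // dvdn_exp.
Qed.

(** Since [p] is prime and misses [j] or [k], the two kernel conditions reduce to [p] dividing [n],
    with [m] free. *)
Lemma card_ker_Bjk j k : ~~ ((p %| j) && (p %| k))%N ->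
  #|ker_lambda (Bjk j k)| = (p * q)%N.
Proof.
move=> jk_n0; have -> : ker_lambda (Bjk j k) =
    setX [set n : 'Z_(p ^ 2) | (p %| n)%N] [set: 'Z_q].
  apply/setP => -[n m]; rewrite mem_ker_Bjk in_setX !inE andbT /=.
  rewrite !Euclid_dvdM // -orb_andl; move: jk_n0.
  by case: (p %| n)%N; rewrite ?orbT //; case: (_ && _).
by rewrite cardsX card_dvdn_Zp_sqr cardsT card_ord Zp_cast.
Qed.

Lemma card_ker_Bjk0 j k : (p %| j)%N -> (p %| k)%N ->
  #|ker_lambda (Bjk j k)| = (p ^ 2 * q)%N.
Proof.
move=> pj pk; rewrite -(card_Bjk j k) -cardsT; congr #|pred_of_set _|.
by apply/setP => x; rewrite mem_ker_Bjk !inE !dvdn_mulr.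
Qed.

End BjkInvariants.

(** * Exponents of multiplicative maps *)

Lemma expr1_coprime (A : pzSemiRingType) (x : A) m n :
  coprime m n -> x ^+ m = 1 -> x ^+ n = 1 -> x = 1.
Proof.
(* The exponent [1] is replaced by one congruent to [1] modulo [n] and to [0] modulo [m]. *)
move=> co xm xn; rewrite -[LHS](expr_mod 1 xn) -(chinese_modr co 0).
by rewrite (expr_mod _ xn) -(expr_mod _ xm) chinese_modl // mod0n.
Qed.

(** The fibre of [U] over [1] is a normal subgroup of index [n], so every [n]-th power lies in it.
    It is built by hand because the target is only a semiring. *)
Lemma morph_expr_index (gT : finGroupType) (A : pzSemiRingType) (U : gT -> A) n :
    U 1%g = 1 -> (forall a b, U (a * b)%g = U a * U b) ->
    (#|[set a | U a == 1%R]| * n)%N = #|gT| ->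
  forall a, U a ^+ n = 1.
Proof.
move=> U1 UM; set K := [set a | _] => oK a.
have gK : group_set K.
  apply/group_setP; split=> [|x y]; rewrite !inE ?U1 //.
  by rewrite UM => /eqP-> /eqP->; rewrite mulr1.
pose KG := Group gK.
have nK : (KG <| [set: gT])%g.
  rewrite /normal subsetT; apply/subsetP => y _; rewrite inE.
  apply/subsetP => _ /imsetP[x xK ->]; move: xK; rewrite !inE => /eqP Ux.
  by rewrite !UM Ux mul1r -UM mulVg U1.
have iK : #|[set: gT] / KG|%g = n.
  rewrite card_quotient ?normal_norm // -divgS ?subsetT // cardsT -oK.
  by rewrite mulKn ?(cardG_gt0 KG).
have Na : a \in 'N(KG)%g by apply: (subsetP (normal_norm nK)); rewrite inE.
have : (a ^+ n)%g \in KG.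
  apply: coset_idr; first exact: groupX.
  rewrite morphX //= -iK; apply/expg_cardG/(@mem_quotient _ KG).
  by rewrite inE.
rewrite [_ \in _]inE => /eqP <-; elim: n {oK iK} => [|n IHn]; first by rewrite U1.
by rewrite exprS expgS UM IHn.
Qed.

(** * The map [lambda] of a left brace *)

Section LambdaTheory.

Variable B : leftBraceType.
Implicit Types a b c : B.

Lemma circE a b : a ∘ b = a + lambda a b.
Proof. by rewrite /lambda addrA subrr add0r. Qed.

Lemma lambdaD a b c : lambda a (b + c) = lambda a b + lambda a c.
Proof. by rewrite /lambda circDr !addrA. Qed.

Lemma lambda0 a : lambda a 0 = 0.
Proof. by apply: (addrI (lambda a 0)); rewrite -lambdaD !addr0. Qed.

Lemma lambdaN a b : lambda a (- b) = - lambda a b.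
Proof. by apply: (addrI (lambda a b)); rewrite -lambdaD !subrr lambda0. Qed.

Lemma lambdaM a b c : lambda (a ∘ b) c = lambda a (lambda b c).
Proof.
have -> : lambda a (lambda b c) = - lambda a b + lambda a (b ∘ c).
  by rewrite -lambdaN -lambdaD.
by rewrite /lambda circA opprD opprK addrACA subrr add0r.
Qed.

Lemma circ1_eq0 : circ1 = 0 :> B.
Proof. by rewrite -[RHS]circ1b circE lambda0 addr0. Qed.

End LambdaTheory.

(** * Coordinates on a cyclic additive group, and [p]-th roots of unity *)

Lemma cyclic_add_group_Zp_pair (B : finLeftBraceType) N M :
    (1 < N)%N -> (1 < M)%N -> coprime N M -> #|B| = (N * M)%N ->
    cyclic [set: add_group B] ->
  exists2 f : 'Z_N * 'Z_M -> B, bijective f & forall x y, f (x + y) = f x + f y.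
Proof.
move=> N_gt1 M_gt1 co oB /cyclic_add_groupP[g gP].
have gN : ((g : add_group B) ^+ (N * M) = 1)%g.
  have -> : (N * M)%N = #|[set: add_group B]| by rewrite cardsT oB.
  by rewrite expg_cardG ?inE.
pose f (x : 'Z_N * 'Z_M) : B := g *+ chinese N M x.1 x.2.
have fE n : f (1 *+ n) = g *+ n.
  rewrite /f pair_natr /= !val_Zp_nat // -!add_group_expg -[LHS](expg_mod _ gN).
  by rewrite -[RHS](expg_mod _ gN) [in RHS](chinese_mod co n).
have natP x := Zp_pair_natr x N_gt1 M_gt1 co.
exists f => [|x y]; last first.
  have [[n ->] [m ->]] := (natP x, natP y).
  by rewrite -mulrnDr !fE mulrnDr.
have oR : #|{: 'Z_N * 'Z_M}| = #|B| by rewrite card_prod !card_ord !Zp_cast.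
apply: inj_card_bij; last by rewrite oR.
(* Injectivity follows from surjectivity, as both sides have [N * M] elements. *)
suff /imset_injP f_inj : #|f @: [set: 'Z_N * 'Z_M]| == #|[set: 'Z_N * 'Z_M]|.
  by move=> x y; apply: f_inj; rewrite inE.
have -> : f @: [set: 'Z_N * 'Z_M] = [set: B].
  apply/setP => y; rewrite inE; have [n ->] := gP y.
  by apply/imsetP; exists (1 *+ n); rewrite ?inE ?fE.
by rewrite !cardsT oR.
Qed.

(** Fermat's little theorem makes a representative [b] of [w] congruent to [b ^ p], hence to [1],
    modulo [p]; the quotient of [b] by [p] is the witness. *)
Lemma Zp_sqr_unity_root p (w : 'Z_(p ^ 2)) : prime p -> w ^+ p = 1 ->
  exists a : nat, w = a%:R * p%:R + 1.
Proof.
move=> p_prime; have p2_gt1 := prime_sqr_gt1 p_prime.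
have [b ->] := Zp_natr_surj w => /eqP; rewrite -natrX -[1]/1%:R Zp_natr_eq //.
move=> /eqP bp.
have b1 : b = 1 %[mod p].
  have p_dvd : (p %| p ^ 2)%N by rewrite dvdn_exp.
  by rewrite -(fermat_little b p_prime) -(modn_dvdm _ p_dvd) bp modn_dvdm.
exists (b %/ p)%N; rewrite -natrM natr1 {1}(divn_eq b p) b1.
by rewrite modn_small ?prime_gt1 // addn1.
Qed.

(** The unit group of a prime field is cyclic, so [<[r]>] is its only subgroup of order [p]. *)
Lemma Zp_unity_root p q (r : {unit 'Z_q}) (w : 'Z_q) :
    prime p -> prime q -> #[r]%g = p -> w ^+ p = 1 ->
  exists k : nat, w = val r ^+ k.
Proof.
move=> p_prime q_prime r_order wp.
have w_unit : w \is a GRing.unit.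
  by rewrite -(unitrX_pos _ (prime_gt0 p_prime)) wp unitr1.
pose v : {unit 'Z_q} := FinRing.Unit w_unit.
have : (#[v]%g %| p)%N.
  by rewrite order_dvdn -val_eqE FinRing.val_unitX /= wp.
move/(primeP p_prime).2 => /pred2P[v1 | vp].
  by exists 0%N; have /eqP := v1; rewrite order_eq1 => /eqP/(congr1 val).
have /eqP v_r : <[v]>%g == <[r]>%g.
  rewrite (eq_subG_cyclic (units_Zp_cyclic q_prime)) ?subsetT //.
  by rewrite -!orderE vp r_order.
have /cycleP[k vk] : v \in <[r]>%g by rewrite -v_r cycle_id.
by exists k; rewrite -FinRing.val_unitX -vk.
Qed.

(** * Classification and the normal forms in [jk_pairs] *)

Section Classification.

Variables (p q : nat) (r : {unit 'Z_q}).
Hypotheses (p_prime : prime p) (q_prime : prime q) (p_gt2 : (2 < p)%N).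
Hypotheses (co_pq : coprime p q) (r_order : #[r]%g = p).

Local Notation R := ('Z_(p ^ 2) * 'Z_q)%type.
Local Notation Bjk := (Bjk p_prime r_order).

Let p2_gt1 : (1 < p ^ 2)%N := prime_sqr_gt1 p_prime.
Let q_gt1 : (1 < q)%N := prime_gt1 q_prime.

(** This is where [p] being odd enters: then [p] divides ['C(p, 2)]. *)
Lemma natr_bin2_mulp : ('C(p, 2))%:R * p%:R = 0 :> 'Z_(p ^ 2).
Proof.
have /dvdnP[c ->] : (p %| 'C(p, 2))%N by rewrite prime_dvd_bin // p_gt2.
by rewrite natrM -mulrA natr_p_sqr // mulr0.
Qed.

(* If [(V 1).1 = a * p + 1], the [i]-th power of [1] for the operation
   [n, s |-> n + (V n).1 * s] is [i + 'C(i, 2) * a * p], which is [p] for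
   [i = p] because [p] is odd. Hence [V p = V 1 ^+ p = 1], and [V] only depends
   on its argument modulo [p]. *)
Lemma twisted_morphism_exp (V : 'Z_(p ^ 2) -> R) : V 0 = 1 -> V 1 ^+ p = 1 ->
    (forall n s, V (n + (V n).1 * s) = V n * V s) ->
  forall i : nat, V i%:R = V 1 ^+ i.
Proof.
move=> V0 V1p VM.
have [a aE] : exists a : nat, (V 1).1 = a%:R * p%:R + 1.
  by apply: Zp_sqr_unity_root => //; move: V1p; rewrite pair_expr => /(congr1 fst).
have expE i : (V 1 ^+ i).1 = i%:R * (a%:R * p%:R) + 1.
  rewrite pair_expr /= aE; elim: i => [|i IHi]; first by rewrite mul0r add0r.
  rewrite exprS IHi -natr1.
  transitivity (i%:R * a%:R ^+ 2 * (p%:R * p%:R)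
    + (i%:R + 1) * (a%:R * p%:R) + 1 : 'Z_(p ^ 2)); first by ring.
  by rewrite natr_p_sqr // mulr0 add0r.
have VX i : V (i%:R + ('C(i, 2))%:R * (a%:R * p%:R)) = V 1 ^+ i.
  elim: i => [|i IHi]; first by rewrite mul0r add0r.
  rewrite exprSr -IHi -VM IHi expE binS bin1 natrD -natr1; congr V; ring.
have Vp : V p%:R = 1.
  by rewrite -V1p -VX mulrCA natr_bin2_mulp mulr0 addr0.
have V_mod s (t : nat) : V (s + t%:R * p%:R) = V s.
  elim: t => [|t IHt]; first by rewrite mul0r addr0.
  rewrite -natr1 mulrDl mul1r addrA addrC -[s + _]mul1r.
  by have := VM p%:R (s + t%:R * p%:R); rewrite Vp IHt !mul1r.
by move=> i; rewrite -VX mulrA -natrM V_mod.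
Qed.

Lemma brace_classification (B : finLeftBraceType) :
    #|B| = (p ^ 2 * q)%N -> cyclic [set: add_group B] ->
    #|ker_lambda B| = (p * q)%N ->
  exists j k : nat, brace_iso B (Bjk j k).
Proof.
move=> oB cycB oK.
have co : coprime (p ^ 2) q by rewrite coprimeXl.
have [f [h fK hK] fD] := cyclic_add_group_Zp_pair p2_gt1 q_gt1 co oB cycB.
have hD a b : h (a + b) = h a + h b.
  by apply: (can_inj fK); rewrite fD !hK.
have f0 : f 0 = 0 by apply: (addrI (f 0)); rewrite -fD !addr0.
have h0 : h 0 = 0 by rewrite -f0 fK.
(* The scalar by which [lambda a] acts after transport to [R]: its value at the generator [1]. *)
pose u a : R := h (lambda a (f 1)).
have uE a b : h (lambda a b) = u a * h b.
  rewrite -{1}[b]hK.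
  apply: (additive_Zp_pair p2_gt1 q_gt1 co (f := fun x => h (lambda a (f x)))).
  by move=> x y; rewrite fD lambdaD hD.
have circ_h a b : h (a ∘ b) = h a + u a * h b by rewrite circE hD uE.
have uM a b : u (a ∘ b) = u a * u b by rewrite {1}/u lambdaM uE.
have u1 : u circ1 = 1.
  apply: (addrI (h circ1)); have := circ_h circ1 (f 1).
  by rewrite circ1b fK circ1_eq0 h0 add0r mulr1 => <-; rewrite add0r.
have kerE : ker_lambda B = [set a : circ_group B | u a == 1].
  apply/setP => a; rewrite !inE; apply/forallP/eqP => [aP | ua b].
    by rewrite /u (eqP (aP (f 1))) fK.
  by rewrite -(inj_eq (can_inj hK)) uE ua mul1r.
have uX a i : u ((a : circ_group B) ^+ i)%g = u a ^+ i.
  elim: i => [|i IHi]; first exact: u1.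
  by rewrite expgS exprS -IHi -uM.
(* The kernel of [u] is [ker_lambda B], of index [p ^ 2 * q / (p * q) = p]. *)
have u_p a : u a ^+ p = 1.
  apply: (@morph_expr_index (circ_group B) _ u p u1 uM).
  by rewrite -kerE oK mulnAC mulnn -oB.
(* [Q] corresponds to [0 * 'Z_q], which has order prime to [p]: hence [u = 1]
   there. *)
pose Q := [set a : circ_group B | (h a).1 == 0].
have gQ : group_set Q.
  apply/group_setP; split=> [|a b]; rewrite !inE.
    by rewrite [1%g]circ1_eq0 h0.
  move=> /eqP a0 /eqP b0; rewrite [(a * b)%g]/(a ∘ b) circ_h /=.
  by rewrite a0 b0 mulr0 addr0.
have oQ : #|Group gQ| = q.
  transitivity #|[set x : R | x.1 == 0]|.
    rewrite -(card_imset _ (can_inj hK)); congr #|pred_of_set _|.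
    apply/setP => x; rewrite -[x]fK (mem_imset _ _ (can_inj hK)).
    by rewrite [LHS]inE inE.
  have -> : [set x : R | x.1 == 0] = setX [set 0] [set: 'Z_q].
    by apply/setP => -[n m]; rewrite in_setX !inE andbT.
  by rewrite cardsX cards1 mul1n cardsT card_ord Zp_cast.
have uQ a : (h a).1 = 0 -> u a = 1.
  move=> a0; apply: (expr1_coprime co_pq (u_p a)).
  have aQ : (a : circ_group B) \in Group gQ by rewrite inE a0.
  have := expg_cardG aQ; rewrite oQ => aq.
  suff <- : u ((a : circ_group B) ^+ q)%g = u a ^+ q by rewrite aq.
  exact: uX.
pose V n := u (f (n, 0)).
(* As [u] is trivial at [(0, m)], the circle product of [(0, m)] and [(n, 0)] is their sum
   [(n, m)]. *)
have uV x : u (f x) = V x.1.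
  case: x => n m; rewrite /V -[RHS]mul1r -[in RHS](uQ (f (0, m))) ?fK // -uM.
  congr u; apply: (can_inj hK); rewrite circ_h !fK uQ ?fK // mul1r.
  by congr pair; rewrite /= ?add0r ?addr0.
have VE : forall i : nat, V i%:R = V 1 ^+ i.
  apply: twisted_morphism_exp => [||n s].
  - by rewrite /V [f _]f0 -circ1_eq0.
  - exact: u_p.
  rewrite /V -uM; congr u; apply: (can_inj hK); rewrite circ_h !fK.
  by congr pair; rewrite /= mulr0 addr0.
have V1p := u_p (f (1, 0)); rewrite -/(V 1) pair_expr in V1p.
have [j jE] := Zp_sqr_unity_root p_prime (congr1 fst V1p).
have [k kE] := Zp_unity_root p_prime q_prime r_order (congr1 snd V1p).
(* Only the linear term of [(j p + 1) ^ i] survives, since [p * p = 0]. *)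
have VjkE i : V i%:R = (j%:R * i%:R * p%:R + 1, val r ^+ (k * i)).
  rewrite VE pair_expr /= kE exprM jE; congr pair.
  elim: i => [|i IHi]; first by rewrite mulr0 mul0r add0r.
  rewrite exprS IHi -natr1.
  transitivity (j%:R ^+ 2 * i%:R * (p%:R * p%:R) + j%:R * (i%:R + 1) * p%:R + 1
                : 'Z_(p ^ 2)); first by ring.
  by rewrite natr_p_sqr // mulr0 add0r.
exists j, k, h; split; first by exists f.
  exact: hD.
move=> a b; rewrite circ_Bjk circ_h.
have -> : u a = V (h a).1 by rewrite -uV hK.
case: (h a) (h b) => [n m] [s t]; have [i ->] := Zp_natr_surj n.
by rewrite VjkE Bjk_circE.
Qed.

(** Normalisation of projective coordinates: divide by [k] if it is invertible modulo [p], otherwise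
    by [j]. *)
Lemma Bjk_jk_pairs j k : ~~ ((p %| j) && (p %| k))%N ->
  exists2 jk, jk \in jk_pairs p & brace_iso (Bjk j k) (Bjk jk.1 jk.2).
Proof.
have [pk | npk _] := boolP (p %| k)%N.
  rewrite andbT => npj.
  exists (1, 0)%N; rewrite ?mem_head //.
  apply: (@Bjk_scale _ _ _ _ _ _ _ _ _ j); first by rewrite prime_coprime.
    by rewrite mul1n.
  by rewrite mul0n (eqP pk) mod0n.
have co : coprime p k by rewrite prime_coprime.
(* [x] is congruent to [j] modulo [p] and divisible by [k], so [x / k] represents [j / k] modulo
   [p]. *)
pose x := chinese p k j 0.
have /dvdnP[c cE] : (k %| x)%N by rewrite /dvdn chinese_modr // mod0n.
exists (c %% p, 1)%N.
  rewrite inE; apply/orP; right; apply: map_f.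
  by rewrite mem_iota ltn_mod prime_gt0.
apply: (Bjk_scale _ _ co); last by rewrite mul1n.
by rewrite modnMml -cE chinese_modl.
Qed.

Lemma jk_pairsP jk :
  reflect (jk = (1, 0)%N \/ exists2 j, (j < p)%N & jk = (j, 1)%N)
          (jk \in jk_pairs p).
Proof.
rewrite inE.
apply: (iffP predU1P) => -[-> | jkP]; [by left | right | by left | right].
  by have /mapP[j + ->] := jkP; rewrite mem_iota => /andP[_ lt_jp]; exists j.
by have [j lt_jp ->] := jkP; apply: map_f; rewrite mem_iota.
Qed.

Lemma jk_pairs_ndvd jk : jk \in jk_pairs p -> ~~ ((p %| jk.1) && (p %| jk.2))%N.
Proof.
by case/jk_pairsP => [->|[j _ ->]] /=; rewrite dvdn1 gtn_eqF ?andbF // prime_gt1.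
Qed.

Lemma jk_pairs_iso_inj jk jk' : jk \in jk_pairs p -> jk' \in jk_pairs p ->
  brace_iso (Bjk jk.1 jk.2) (Bjk jk'.1 jk'.2) -> jk = jk'.
Proof.
have co : coprime (p ^ 2) q by rewrite coprimeXl.
have p_gt1 := prime_gt1 p_prime.
have not01 : 0 <> 1 %[mod p] by rewrite mod0n modn_small.
move=> jkP jk'P /(Bjk_iso_inv co q_gt1)[c []]; move: jkP jk'P.
case/jk_pairsP => [->|[j lt_j ->]] /jk_pairsP[->|[j' lt_j' ->]] /=;
  rewrite ?mul1n ?mul0n // => jE cE.
(* For [(1, 0)] against [(j', 1)] the scalar [c] would vanish modulo [p], whereas [1 = j' * c]. The
   reverse comparison gives [1 = 0] at once, and two pairs [(j, 1)], [(j', 1)] force [c = 1]. *)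
- by case: not01; rewrite jE -modnMmr -cE mod0n muln0 mod0n.
- by case: not01.
by congr pair; move: jE; rewrite -modnMmr -cE modnMmr muln1 !modn_small.
Qed.

End Classification.

(** * A presentation of a semidirect product of cyclic groups *)

Section Presentation.

Local Open Scope group_scope.

Lemma conj_expg (gT : groupType) (x y : gT) e : x ^ y = x ^+ e ->
  forall j i : nat, (x ^+ j) ^ (y ^+ i) = x ^+ (j * e ^ i).
Proof.
move=> xy j; elim=> [|i IHi]; first by rewrite conjg1 muln1.
by rewrite expgSr conjgM IHi conjXg xy -expgM expnS mulnCA.
Qed.

(** Coprime orders make [gT] the semidirect product of [<[t]>] by [<[s]>]. For [x], [y] satisfying
    the relations, the maps [s] to [x] and [t] to [y] respect conjugation and glue to a morphism
    onto the group they generate. *)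
Lemma Grp_sdprod (gT : finGroupType) (s t : gT) m n e :
    #[s] = m -> #[t] = n -> s * t * s^-1 = t ^+ e -> coprime m n ->
    #|gT| = (m * n)%N ->
  [set: gT] \isog Grp (sigma : tau :
    sigma ^+ m, tau ^+ n, sigma * tau * sigma^-1 = tau ^+ e).
Proof.
move=> os ot st co oG.
(* [a ^ b] is [b^-1 * a * b], so the relation is conjugation by [s^-1]; hence the passages to
   inverse generators below. *)
have ts : t ^ s^-1 = t ^+ e by rewrite conjgE invgK mulgA.
have nts : <[s]> \subset 'N(<[t]>).
  by rewrite -cycleV norms_cycle ts mem_cycle.
have TI : <[t]> :&: <[s]> = 1.
  by apply: coprime_TIg; rewrite -!orderE os ot coprime_sym.
have defG : <[t]> ><| <[s]> = [set: gT].
  rewrite sdprodE //; apply/eqP; rewrite eqEcard subsetT /=.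
  by rewrite TI_cardMg // -!orderE os ot cardsT oG mulnC.
apply: intro_isoGrp => [|rT H].
  apply/existsP; exists (s, t).
  rewrite /= !xpair_eqE st -os -ot !expg_order !eqxx !andbT.
  have [_ <- _ _] := sdprodP defG.
  by rewrite -norm_joinEr // joingC.
case/existsP=> -[x y] /= /eqP[defH xm yn xy].
have yx : y ^ x^-1 = y ^+ e by rewrite conjgE invgK mulgA.
have fsP : (#[x] %| #[s])%N by rewrite order_dvdn os xm.
have ftP : (#[y] %| #[t])%N by rewrite order_dvdn ot yn.
have fP : {in <[t]> & <[s]>, morph_act 'J 'J (eltm ftP) (eltm fsP)}.
  move=> _ si /cycleP[j ->]; rewrite -cycleV => /cycleP[i ->] /=.
  rewrite (conj_expg ts) eltmE eltmE morphX ?groupV ?cycle_id //.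
  by rewrite morphV ?cycle_id //= eltm_id (conj_expg yx).
apply/homgP; exists (sdprodm_morphism defG fP).
rewrite /= im_sdprodm !morphim_cycle ?cycle_id //= !eltm_id -defH.
rewrite joingC norm_joinEr //.
by rewrite -[<[x]>%G : {set _}]cycleV norms_cycle yx mem_cycle.
Qed.

End Presentation.

(** * The circle group of [Bjk j k] *)

Section CircGroup.

Variables (p q : nat) (r : {unit 'Z_q}).
Hypotheses (p_prime : prime p) (q_prime : prime q) (p_gt2 : (2 < p)%N).
Hypotheses (co_pq : coprime p q) (r_order : #[r]%g = p).

Local Notation Bjk := (Bjk p_prime r_order).

Variables j k : nat.

Let p2_gt1 : (1 < p ^ 2)%N := prime_sqr_gt1 p_prime.
Let q_gt1 : (1 < q)%N := prime_gt1 q_prime.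

Let sigma : circ_group (Bjk j k) := (1, 0).
Let tau : circ_group (Bjk j k) := (0, 1).

Lemma mulg_Bjk (x y : circ_group (Bjk j k)) : (x * y)%g = Bjk_circ r j k x y.
Proof. by []. Qed.

Lemma tau_exp i : (tau ^+ i)%g = (0, i%:R) :> Bjk j k.
Proof.
elim: i => // i IHi; rewrite expgS IHi mulg_Bjk.
rewrite [LHS](Bjk_circE p_prime r_order j k 0 1 0 i%:R).
by rewrite muln0 expr0 !mulr0 !add0r mul1r -mulrS.
Qed.

(** Each new factor [sigma] adds [i * j * p] beyond the plain increment; these sum to the binomial
    term, and multiples of [p * p] vanish. *)
Lemma sigma_exp i :
  (sigma ^+ i)%g = (i%:R + ('C(i, 2))%:R * (j%:R * p%:R), 0) :> Bjk j k.
Proof.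
elim: i => [|i IHi]; first by congr pair; rewrite mul0r addr0.
rewrite expgS IHi mulg_Bjk.
rewrite [LHS](Bjk_circE p_prime r_order j k 1 0 _ 0) mulr0 addr0; congr pair.
rewrite binS bin1 natrD -[i.+1%:R]natr1.
transitivity (1 + i%:R + ('C(i, 2)%:R + i%:R) * (j%:R * p%:R)
    + 'C(i, 2)%:R * j%:R * j%:R * (p%:R * p%:R) : 'Z_(p ^ 2)); first by ring.
by rewrite natr_p_sqr // mulr0 addr0; ring.
Qed.

Lemma order_tau : #[tau]%g = q.
Proof. by apply: nt_prime_order => //; rewrite [LHS]tau_exp pchar_Zp. Qed.

(** The binomial term dies at [i = p], so [sigma ^+ p] is [(p, 0)], which is nontrivial but has
    trivial [p]-th power. *)
Lemma order_sigma : #[sigma]%g = (p ^ 2)%N.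
Proof.
have sp : (sigma ^+ p)%g = (p%:R, 0) :> Bjk j k.
  by rewrite sigma_exp mulrCA natr_bin2_mulp // mulr0 addr0.
have sp_exp i : ((sigma ^+ p) ^+ i)%g = (i%:R * p%:R, 0) :> Bjk j k.
  elim: i => [|i IHi]; first by rewrite mul0r.
  rewrite expgS IHi [(sigma ^+ p)%g]sp mulg_Bjk Bjk_circE // mulr0 addr0.
  congr pair; rewrite -mulrA natr_p_sqr // mulr0 add0r mul1r.
  by rewrite -natr1 mulrDl mul1r addrC.
have : (#[sigma]%g %| p ^ 2)%N.
  by rewrite order_dvdn -mulnn expgM [X in X == _]sp_exp natr_p_sqr.
case/(dvdn_pfactor _ _ p_prime) => m; case: m => [|[|[|//]]] //= _ o_s.
  have := expg_order sigma; rewrite o_s expg1 => /(congr1 fst)/eqP.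
  by rewrite oner_eq0.
have := expg_order sigma; rewrite o_s expn1 [LHS]sp => /(congr1 fst) /= /eqP.
rewrite -[p%:R]mul1r -[1]/1%:R -[0](mul0r p%:R) -[0]/0%:R natr_mulp_eq //.
by rewrite mod0n modn_small ?prime_gt1.
Qed.

Lemma sigma_conj_tau :
  (sigma * tau * sigma^-1 = tau ^+ (val r ^+ k : 'Z_q)%R)%g.
Proof.
apply: (mulIg sigma); rewrite mulgKV.
rewrite [X in (X * sigma)%g]tau_exp natr_Zp !mulg_Bjk.
rewrite [LHS](Bjk_circE p_prime r_order j k 1 0 0 1).
rewrite [RHS](Bjk_circE p_prime r_order j k 0 _ 1 0).
by rewrite !mulr0 mul0r !add0r !addr0 muln1 !mulr1.
Qed.

Lemma card_circ_Bjk : #|{: circ_group (Bjk j k)}| = (p ^ 2 * q)%N.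
Proof. by rewrite -(card_Bjk p_prime r_order q_gt1 j k). Qed.

(** For [k = 0] the elements [sigma] and [tau] commute and have coprime orders, so their product
    generates the group. *)
Lemma circ_Bjk_cyclic : k = 0%N ->
  ([set: circ_group (Bjk j k)] \isog [set: 'Z_(p ^ 2 * q)])%g.
Proof.
move=> k0; have co : coprime (p ^ 2) q by rewrite coprimeXl.
have st : (sigma * tau)%g = (tau * sigma)%g.
  by have := sigma_conj_tau; rewrite k0 expr0 expg1 => /(canRL (mulgVK _)).
have o_st : #[sigma * tau]%g = (p ^ 2 * q)%N.
  by rewrite orderM // order_sigma order_tau.
have cyc : cyclic [set: circ_group (Bjk j k)].
  apply/cyclicP; exists (sigma * tau)%g; apply/esym/eqP.
  by rewrite eqEcard subsetT cardsT card_circ_Bjk -orderE o_st /=.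
rewrite isog_cyclic_card // !cardsT card_circ_Bjk card_ord Zp_cast ?eqxx ?andbT.
  by apply/cyclicP; exists Zp1; exact: Zp_cycle.
by rewrite (leq_trans q_gt1) // leq_pmull // ltnW.
Qed.

Lemma circ_Bjk_Grp : k = 1%N ->
  ([set: circ_group (Bjk j k)] \isog
       Grp (sigma : tau : sigma ^+ (p ^ 2), tau ^+ q,
              sigma * tau * sigma^-1 = tau ^+ (val r)))%g.
Proof.
move=> k1; apply: (Grp_sdprod order_sigma order_tau); last exact: card_circ_Bjk.
  by rewrite sigma_conj_tau k1.
by rewrite coprimeXl.
Qed.

End CircGroup.

(* Assembly of classification, non-isomorphism and circle groups *)
Local Close Scope brace_scope.
Local Close Scope ring_scope.

Theorem proposition5p2 (p q : nat) (p_prime : prime p) (q_prime : prime q)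
  (p_gt2 : 2 < p) (q_mod_p : q = 1 %[mod p]) (q_mod_p2 : q <> 1 %[mod p ^ 2])
  (r : {unit 'Z_q}) (r_order : #[r]%g = p) :
  (forall B : finLeftBraceType,
     [/\ #|B| = p ^ 2 * q, cyclic [set: add_group B] & #|ker_lambda B| = p * q]
     <-> exists2 jk, jk \in jk_pairs p
                   & brace_iso B (Bjk p_prime r_order jk.1 jk.2)) /\
  (forall jk jk' : nat * nat, jk \in jk_pairs p -> jk' \in jk_pairs p ->
     jk <> jk' ->
     ~ brace_iso (Bjk p_prime r_order jk.1 jk.2)
                 (Bjk p_prime r_order jk'.1 jk'.2)) /\
  ([set: circ_group (Bjk p_prime r_order 1%N 0%N)] \isog [set: 'Z_(p ^ 2 * q)])%g /\
  (forall j k : nat, (j, k) \in jk_pairs p -> (j, k) <> (1, 0)%N ->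
     [set: circ_group (Bjk p_prime r_order j k)] \isog
       Grp (sigma : tau : sigma ^+ (p ^ 2), tau ^+ q,
              sigma * tau * sigma^-1 = tau ^+ (val r)))%g.
Proof.
have [p_gt1 q_gt1] := (prime_gt1 p_prime, prime_gt1 q_prime).
have co_pq : coprime p q.
  by rewrite /coprime -gcdn_modr q_mod_p gcdn_modr gcdn1.
split=> [B|]; last split=> [jk jk' jkP jk'P neq_jk iso_jk|]; last split.
- split=> [[oB cycB oK] | [jk jkP isoB]].
    have [j [k isoB]] :=
      brace_classification p_prime q_prime p_gt2 co_pq r_order oB cycB oK.
    have [|jk jkP iso_jk] := @Bjk_jk_pairs p q r p_prime r_order j k.
      (* If [p] divided both [j] and [k], the kernel would be the whole brace, of size [p ^ 2 * q]
         instead of [p * q]. *)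
      apply/negP => /andP[pj pk]; have := brace_iso_ker_lambda isoB.
      rewrite oK card_ker_Bjk0 // => /eqP; rewrite eqn_pmul2r ?prime_gt0 //.
      by rewrite -mulnn -{1}[p]muln1 eqn_pmul2l ?prime_gt0 // ltn_eqF.
    by exists jk => //; apply: brace_iso_trans iso_jk.
  split.
  - by rewrite (brace_iso_card isoB) card_Bjk.
  - by apply: (brace_iso_cyclic isoB); apply: cyclic_Bjk.
  - by rewrite (brace_iso_ker_lambda isoB) card_ker_Bjk // jk_pairs_ndvd.
- exact: neq_jk (jk_pairs_iso_inj q_prime co_pq jkP jk'P iso_jk).
- exact: circ_Bjk_cyclic.
move=> j k jkP jk_neq10; apply: circ_Bjk_Grp => //.
by case/jk_pairsP: jkP => [//|[_ _ [_ ->]]].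
Qed.
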